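(* Let $Q\in\mathbb{R}^{d\times d}$, $R\in\mathbb{R}^{p\times p}$, $W\in\mathbb{R}^{d\times d}$ be symmetric positive definite, let $0\le\alpha<1/2$, and let $(A_t,B_t)_{t\ge1}$ be any sequence with $A_t\in\mathbb{R}^{d\times d}$, $B_t\in\mathbb{R}^{d\times p}$. Suppose that for every $t$ the semidefinite program $\mathrm{SDP}(A_t,B_t;\alpha)$ is feasible, and let $K_t$ be the COCO-LQ gain computed from an optimal solution of it. Then the sequence of policies $K_1,K_2,\dots$ is $(\kappa,\gamma,\rho)$-sequential strongly stable for the system $(A_t,B_t)_{t\ge1}$, with $$\kappa=\frac{\kappa_W}{\sqrt{1-\alpha}},\qquad \gamma=1-\sqrt{\alpha},\qquad \rho=\sqrt{\frac{\alpha}{1-\alpha}},$$ where $\kappa_W=\|W\|\,\|W^{-1}\|$.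
   Context: Matrix norms are spectral norms; $X\preceq Y$ means $Y-X$ is positive semidefinite; $X\bullet Y=\mathrm{Tr}(X^\top Y)$. For $A\in\mathbb{R}^{d\times d}$, $B\in\mathbb{R}^{d\times p}$ and $\alpha\in[0,1)$, $\mathrm{SDP}(A,B;\alpha)$ denotes the following program over symmetric matrices $\Sigma=\begin{bmatrix}\Sigma_{xx}&\Sigma_{xu}\\ \Sigma_{xu}^\top&\Sigma_{uu}\end{bmatrix}\in\mathbb{R}^{(d+p)\times(d+p)}$ with $\Sigma_{xx}\in\mathbb{R}^{d\times d}$: minimize $\begin{bmatrix}Q&0\\0&R\end{bmatrix}\bullet\Sigma$ subject to (i) $\Sigma_{xx}=[A\ \ B]\,\Sigma\,[A\ \ B]^\top+W$; (ii) $\Sigma\succeq 0$; (iii) $[A\ \ B]\,\Sigma\,[A\ \ B]^\top\preceq\alpha\,\Sigma_{xx}$. The COCO-LQ gain at time $t$ is $K_t=\Sigma_{xu}^\top\Sigma_{xx}^{-1}$, where $\Sigma$ is an optimal solution of $\mathrm{SDP}(A_t,B_t;\alpha)$; the control is $u_t=K_tx_t$ in the system $x_{t+1}=A_tx_t+B_tu_t+w_t$. Sequential strong stability: a sequence of gains $K_1,K_2,\dots$ is $(\kappa,\gamma,\rho)$-sequential strongly stable for $(A_t,B_t)_{t\ge1}$ (for $\kappa>0$, $0<\gamma\le1$, $0\le\rho<1$) if there exist constants $\beta_1,\beta_2>0$ with $\kappa=\beta_1/\beta_2$, invertible matrices $H_1,H_2,\dots$ and matrices $L_1,L_2,\dots$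 such that $A_t+B_tK_t=H_tL_tH_t^{-1}$ for all $t$, with the following properties: (a) $\|L_t\|\le1-\gamma$; (b) $\|H_t\|\le\beta_1$ and $\|H_t^{-1}\|\le1/\beta_2$; (c) $\|H_{t+1}^{-1}H_t\|\le\frac{\rho}{1-\gamma}$.
   Formalization: For α=0 one has γ=1 and ρ=0, so the bound ρ/(1−γ) in condition (c) is the undefined 0/0; condition (c) is then taken as no constraint. The dimension d is assumed at least 1, since d=0 would give κ=0. *)

(* Defs.v *)
From mathcomp Require Import all_boot all_order all_algebra.
From mathcomp Require Import classical_sets reals.

Set Implicit Arguments.
Unset Strict Implicit.
Unset Printing Implicit Defensive.

Import Order.TTheory GRing.Theory Num.Theory.

Local Open Scope classical_set_scope.
Local Open Scope ring_scope.

Definition vnorm (F : realType) (n : nat) (v : 'cV[F]_n) : F :=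
  Num.sqrt (\sum_i v i 0 ^+ 2).

(* The operator norm induced by the Euclidean norm.  MathComp-Analysis' own
   norm on matrices is the entrywise sup norm, hence the dedicated definition.
   The set below contains 0 and is bounded, so [sup] is a genuine supremum. *)
Definition spectral_norm (F : realType) (m n : nat) (X : 'M[F]_(m, n)) : F :=
  sup [set vnorm (X *m v) | v in [set v : 'cV[F]_n | vnorm v <= 1]].

Definition posdefmx (F : realType) (n : nat) (X : 'M[F]_n) : Prop :=
  X^T = X /\ forall v : 'cV[F]_n, v != 0 -> 0 < (v^T *m X *m v) 0 0.

Definition psdmx (F : realType) (n : nat) (X : 'M[F]_n) : Prop :=
  X^T = X /\ forall v : 'cV[F]_n, 0 <= (v^T *m X *m v) 0 0.

Definition loewner_le (F : realType) (n : nat) (X Y : 'M[F]_n) : Prop :=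
  psdmx (Y - X).

Definition frobdot (F : realType) (m n : nat) (X Y : 'M[F]_(m, n)) : F :=
  \tr (X^T *m Y).

Section SDP.
Variables (F : realType) (d p : nat).
Variables (Q : 'M[F]_d) (R : 'M[F]_p) (W : 'M[F]_d).
Variables (A : 'M[F]_d) (B : 'M[F]_(d, p)) (alpha : F).

Definition sdp_objective (S : 'M[F]_(d + p)) : F :=
  frobdot (block_mx Q 0 0 R) S.

Definition sdp_feasible (S : 'M[F]_(d + p)) : Prop :=
  let AB := row_mx A B in
  [/\ S^T = S,
      ulsubmx S = AB *m S *m AB^T + W,
      psdmx S
    & loewner_le (AB *m S *m AB^T) (alpha *: ulsubmx S)].

Definition sdp_optimal (S : 'M[F]_(d + p)) : Prop :=
  sdp_feasible S /\
  forall S', sdp_feasible S' -> sdp_objective S <= sdp_objective S'.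

(* The optimal solution is not assumed unique: [K] is a gain as soon as it
   comes from some optimal solution. *)
Definition coco_lq_gain (K : 'M[F]_(p, d)) : Prop :=
  exists S, sdp_optimal S /\ K = (ursubmx S)^T *m invmx (ulsubmx S).

End SDP.

(* Sequences indexed by t >= 1 are functions on [nat] whose value at 0 is
   irrelevant.  When gamma = 1 the quotient rho / (1 - gamma) has a zero
   denominator; the last condition is then read as no constraint (in
   MathComp it would otherwise collapse to a bound by 0). *)
Definition seq_strongly_stable (F : realType) (d p : nat)
    (A : nat -> 'M[F]_d) (B : nat -> 'M[F]_(d, p)) (K : nat -> 'M[F]_(p, d))
    (kappa gamma rho : F) : Prop :=
  [/\ 0 < kappa, 0 < gamma <= 1, 0 <= rho < 1 &
  exists (beta1 beta2 : F) (H L : nat -> 'M[F]_d),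
  [/\ 0 < beta1, 0 < beta2, kappa = beta1 / beta2 &
  forall t, (1 <= t)%N ->
  [/\ H t \in unitmx /\ A t + B t *m K t = H t *m L t *m invmx (H t),
      spectral_norm (L t) <= 1 - gamma,
      spectral_norm (H t) <= beta1 /\
        spectral_norm (invmx (H t)) <= beta2^-1
    & gamma < 1 ->
        spectral_norm (invmx (H t.+1) *m H t) <= rho / (1 - gamma)]]].

(* Main.v *)
(** Factor [Sigma_xx = H H^T].  Constraints (i) and (iii) give
    [W <= Sigma_xx <= W / (1 - alpha)] with bounds independent of [t], which
    controls [H_t], [H_t^-1] and [H_(t+1)^-1 H_t].  Since
    [[A B] Sigma [A B]^T - (A + B K) Sigma_xx (A + B K)^T] is a congruence of
    the Schur complement of [Sigma_xx], constraint (iii) yields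
    [L L^T <= alpha I] for [L = H^-1 (A + B K) H].  Only [H H^T] matters, so a
    Cholesky factor serves in place of the symmetric square root. *)

Require Import Defs.
From mathcomp Require Import all_boot all_order all_algebra.
From mathcomp Require Import boolp classical_sets reals.
From mathcomp Require Import lra.

Import Order.TTheory GRing.Theory Num.Theory.
Local Open Scope ring_scope.

(** * Euclidean inner product and norm *)

Definition dot {F : realType} {n : nat} (u v : 'cV[F]_n) : F := (u^T *m v) 0 0.

Section SpectralNorm.
Set Implicit Arguments.
Unset Strict Implicit.
Unset Printing Implicit Defensive.
Variable F : realType.
Implicit Types m n : nat.

Lemma dotE n (u v : 'cV[F]_n) : dot u v = \sum_i u i 0 * v i 0.
Proof. by rewrite /dot mxE; apply: eq_bigr => i _; rewrite mxE. Qed.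

Lemma dotC n (u v : 'cV[F]_n) : dot u v = dot v u.
Proof. by rewrite !dotE; apply: eq_bigr => i _; rewrite mulrC. Qed.

Lemma dotDr n (u v w : 'cV[F]_n) : dot u (v + w) = dot u v + dot u w.
Proof. by rewrite /dot mulmxDr mxE. Qed.

Lemma dotZr n a (u v : 'cV[F]_n) : dot u (a *: v) = a * dot u v.
Proof. by rewrite /dot -scalemxAr mxE. Qed.

Lemma dotDl n (u v w : 'cV[F]_n) : dot (v + w) u = dot v u + dot w u.
Proof. by rewrite dotC dotDr !(dotC u). Qed.

Lemma dotZl n a (u v : 'cV[F]_n) : dot (a *: u) v = a * dot u v.
Proof. by rewrite dotC dotZr dotC. Qed.

Lemma dot_mulmxr m n (u : 'cV[F]_m) (X : 'M_(m, n)) v :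
  dot u (X *m v) = dot (X^T *m u) v.
Proof. by rewrite /dot trmx_mul trmxK mulmxA. Qed.

Lemma dotvv_ge0 n (v : 'cV[F]_n) : 0 <= dot v v.
Proof. by rewrite dotE; apply: sumr_ge0 => i _; rewrite -expr2 sqr_ge0. Qed.

Lemma dotvv_eq0 n (v : 'cV[F]_n) : (dot v v == 0) = (v == 0).
Proof.
apply/eqP/eqP => [|->]; last by rewrite /dot mulmx0 mxE.
rewrite dotE => /eqP; rewrite psumr_eq0; last first.
  by move=> i _; rewrite -expr2 sqr_ge0.
move=> /allP v0; apply/matrixP => i j; rewrite ord1 mxE.
by have := v0 i (mem_index_enum i); rewrite /= mulf_eq0 orbb => /eqP.
Qed.

Lemma dot_CauchySchwarz n (u v : 'cV[F]_n) :
  dot u v ^+ 2 <= dot u u * dot v v.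
Proof.
have [->|v0] := eqVneq v 0; first by rewrite /dot !mulmx0 mxE expr0n mulr0.
have v_gt0 : 0 < dot v v by rewrite lt0r dotvv_eq0 v0 dotvv_ge0.
(* The squared length of this vector is [dot v v] times the Cauchy-Schwarz gap, and the positive
   factor is then cancelled. *)
have := dotvv_ge0 (dot v v *: u + (- dot u v) *: v).
rewrite !(dotDl, dotDr, dotZl, dotZr) (dotC v u) => h.
by rewrite -subr_ge0 -(pmulr_rge0 _ v_gt0); apply: le_trans h _; nra.
Qed.

Lemma vnormE n (v : 'cV[F]_n) : vnorm v = Num.sqrt (dot v v).
Proof. by rewrite /vnorm dotE. Qed.

Lemma sqr_vnorm n (v : 'cV[F]_n) : vnorm v ^+ 2 = dot v v.
Proof. by rewrite vnormE sqr_sqrtr ?dotvv_ge0. Qed.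

Lemma vnorm_ge0 n (v : 'cV[F]_n) : 0 <= vnorm v.
Proof. exact: sqrtr_ge0. Qed.

Lemma vnormZ n a (v : 'cV[F]_n) : 0 <= a -> vnorm (a *: v) = a * vnorm v.
Proof.
move=> a0; rewrite !vnormE dotZl dotZr mulrA -expr2.
by rewrite sqrtrM ?sqr_ge0 // sqrtr_sqr ger0_norm.
Qed.

Lemma ler_vnorm m n c (u : 'cV[F]_m) (v : 'cV[F]_n) : 0 <= c ->
  (vnorm u <= c * vnorm v) = (dot u u <= c ^+ 2 * dot v v).
Proof.
move=> c0; rewrite -!sqr_vnorm -exprMn ler_pXn2r ?nnegrE ?vnorm_ge0 //.
by rewrite mulr_ge0 ?vnorm_ge0.
Qed.

Lemma dot_le_vnorm n (u v : 'cV[F]_n) : dot u v <= vnorm u * vnorm v.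
Proof.
rewrite (le_trans (ler_norm _)) // -sqrtr_sqr !vnormE -sqrtrM ?dotvv_ge0 //.
by rewrite ler_wsqrtr ?dot_CauchySchwarz.
Qed.

(** * Spectral norm and quadratic bounds *)

Lemma dot_mulmx_le m n (X : 'M[F]_(m, n)) v :
  dot (X *m v) (X *m v) <= (\sum_i dot (row i X)^T (row i X)^T) * dot v v.
Proof.
rewrite dotE mulr_suml; apply: ler_sum => i _.
have -> : (X *m v) i 0 = dot (row i X)^T v.
  by rewrite /dot trmxK -row_mul [RHS]mxE.
by rewrite -expr2 dot_CauchySchwarz.
Qed.

Local Open Scope classical_set_scope.

(** Cauchy-Schwarz on each row bounds [vnorm (X *m v)] on the unit ball by the Frobenius norm of
    [X]. *)
Lemma spectral_norm_has_sup m n (X : 'M[F]_(m, n)) :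
  has_sup [set vnorm (X *m v) | v in [set v : 'cV[F]_n | vnorm v <= 1]].
Proof.
split.
  by exists (vnorm (X *m 0)), 0 => //=; rewrite vnormE /dot mulmx0 mxE sqrtr0.
set c := \sum_i dot (row i X)^T (row i X)^T.
have c0 : 0 <= c by apply: sumr_ge0 => i _; exact: dotvv_ge0.
exists (Num.sqrt c) => _ [v /= v1 <-].
have : vnorm (X *m v) <= Num.sqrt c * vnorm v.
  by rewrite ler_vnorm ?sqrtr_ge0 // sqr_sqrtr // dot_mulmx_le.
by move/le_trans; apply; rewrite ler_piMr ?sqrtr_ge0.
Qed.

Local Close Scope classical_set_scope.

Lemma spectral_norm_ge0 m n (X : 'M[F]_(m, n)) : 0 <= spectral_norm X.
Proof.
apply: le_trans (vnorm_ge0 (X *m 0)) _.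
apply: sup_upper_bound; first exact: spectral_norm_has_sup.
by exists 0 => //=; rewrite vnormE /dot mulmx0 mxE sqrtr0.
Qed.

Lemma vnorm_mulmx m n (X : 'M[F]_(m, n)) v :
  vnorm (X *m v) <= spectral_norm X * vnorm v.
Proof.
have [->|v0] := eqVneq v 0.
  by rewrite mulmx0 !vnormE /dot !mulmx0 !mxE sqrtr0 mulr0.
have nv_gt0 : 0 < vnorm v.
  by rewrite vnormE sqrtr_gt0 lt0r dotvv_eq0 v0 dotvv_ge0.
rewrite -ler_pdivrMr // mulrC -vnormZ ?invr_ge0 ?vnorm_ge0 // scalemxAr.
apply: sup_upper_bound; first exact: spectral_norm_has_sup.
exists ((vnorm v)^-1 *: v) => //=.
by rewrite vnormZ ?invr_ge0 ?vnorm_ge0 // mulVf ?gt_eqF.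
Qed.

Lemma spectral_norm_le m n c (X : 'M[F]_(m, n)) : 0 <= c ->
  (forall v, dot (X *m v) (X *m v) <= c ^+ 2 * dot v v) -> spectral_norm X <= c.
Proof.
move=> c0 Xc; apply: ge_sup; first by have [] := spectral_norm_has_sup X.
move=> _ [v /= v1 <-]; have : vnorm (X *m v) <= c * vnorm v by rewrite ler_vnorm.
by move/le_trans; apply; rewrite ler_piMr.
Qed.

(** With [s] the squared length of [X^T v], one has [s = <v, X X^T v>]. Cauchy-Schwarz and the bound
    on [X] give [s^2 <= |v|^2 * c * s], and [s] cancels. *)
Lemma dot_trmx_bound m n c (X : 'M[F]_(m, n)) : 0 <= c ->
  (forall v, dot (X *m v) (X *m v) <= c * dot v v) ->
  forall v, dot (X^T *m v) (X^T *m v) <= c * dot v v.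
Proof.
move=> c0 Xc v; set s := dot (X^T *m v) (X^T *m v).
have [s0|s0] := eqVneq s 0; first by rewrite s0 mulr_ge0 ?dotvv_ge0.
have s_gt0 : 0 < s by rewrite lt0r s0 dotvv_ge0.
rewrite -(ler_pM2r s_gt0) -expr2.
have {1}-> : s = dot v (X *m (X^T *m v)) by rewrite dot_mulmxr.
apply: le_trans (dot_CauchySchwarz _ _) _.
by rewrite -mulrA mulrCA ler_wpM2l ?dotvv_ge0 //; exact: Xc.
Qed.

(** Matrix inequalities on [H H^T] control the lengths of vectors [H^T v], so norms are estimated
    through the transpose. *)
Lemma spectral_norm_trmx_le m n c (X : 'M[F]_(m, n)) : 0 <= c ->
  (forall v, dot (X^T *m v) (X^T *m v) <= c ^+ 2 * dot v v) ->
  spectral_norm X <= c.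
Proof.
move=> c0 Xc; apply: spectral_norm_le => // v; rewrite -{1 2}(trmxK X).
by apply: dot_trmx_bound; rewrite ?sqr_ge0.
Qed.

Lemma dot_mulmx_spectral n (X : 'M[F]_n) v :
  dot v (X *m v) <= spectral_norm X * dot v v.
Proof.
apply: le_trans (dot_le_vnorm _ _) _; rewrite -sqr_vnorm expr2.
by rewrite mulrCA ler_wpM2l ?vnorm_ge0 // vnorm_mulmx.
Qed.

Lemma spectral_norm_cond_ge1 n (X : 'M[F]_n) : (0 < n)%N -> X \in unitmx ->
  1 <= spectral_norm X * spectral_norm (invmx X).
Proof.
case: n X => // n X _ Xu; pose v : 'cV[F]_n.+1 := const_mx 1.
have v_gt0 : 0 < vnorm v.
  rewrite vnormE sqrtr_gt0 lt0r dotvv_ge0 dotvv_eq0 andbT.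
  by apply/eqP => /matrixP /(_ 0 0) /eqP; rewrite !mxE oner_eq0.
rewrite -(ler_pM2r v_gt0) mul1r -{1}(mulKVmx Xu v).
apply: le_trans (vnorm_mulmx _ _) _.
by rewrite -mulrA ler_wpM2l ?spectral_norm_ge0 // vnorm_mulmx.
Qed.

(** * Positive definite matrices and Cholesky factorization *)

Lemma psdmx_dot n (X : 'M[F]_n) v : psdmx X -> 0 <= dot v (X *m v).
Proof. by case=> _ /(_ v); rewrite /dot mulmxA. Qed.

Lemma posdefmx_dot n (X : 'M[F]_n) v :
  posdefmx X -> v != 0 -> 0 < dot v (X *m v).
Proof. by case=> _ + v0 => /(_ v v0); rewrite /dot mulmxA. Qed.

Lemma posdefmx_unit n (X : 'M[F]_n) : posdefmx X -> X \in unitmx.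
Proof.
move=> Xpd; rewrite -row_free_unit -kermx_eq0; apply/rowV0P => u /sub_kermxP uX.
apply: contraTeq isT => u0.
have := posdefmx_dot (v := u^T) Xpd; rewrite trmx_eq0 => /(_ u0).
by rewrite /dot trmxK mulmxA uX mul0mx mxE ltxx.
Qed.

(** Induction on the size: split off the first coordinate and factor the Schur complement of the top
    left entry. *)
Lemma cholesky n (X : 'M[F]_n) :
  posdefmx X -> exists H, H \in unitmx /\ X = H *m H^T.
Proof.
suff chol : posdefmx X -> exists H : 'M_n, X = H *m H^T.
  move=> Xpd; have [H XE] := chol Xpd; exists H; split=> //.
  by have := posdefmx_unit Xpd; rewrite XE unitmx_mul => /andP[].
elim: n X => [|n IHn] X Xpd; first by exists 0; apply/matrixP => -[].
pose Y : 'M[F]_(1 + n) := X; have Ypd : posdefmx Y := Xpd; rewrite -/Y.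
pose a := Y 0 0; pose b := ursubmx Y; pose C := drsubmx Y.
have YT : Y^T = Y by case: Ypd.
have bT : dlsubmx Y = b^T by rewrite -{1}YT -trmx_ursub.
have YE : Y = block_mx a%:M b b^T C.
  rewrite -[LHS]submxK bT; congr block_mx; rewrite [LHS]mx11_scalar.
  by rewrite !mxE; congr (_%:M); congr (Y _ _); apply: val_inj.
have a0 : 0 < a.
  have := posdefmx_dot (v := delta_mx 0 0) Ypd.
  have -> : dot (delta_mx 0 0) (Y *m delta_mx 0 0) = a.
    by rewrite /dot trmx_delta -colE -rowE !mxE.
  apply; apply/eqP => /matrixP /(_ 0 0) /eqP; by rewrite !mxE !eqxx oner_eq0.
have [|H HE] := IHn (C - a^-1 *: (b^T *m b)).
  have CT : C^T = C by rewrite /C trmx_drsub YT.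
  split=> [|v v0]; first by rewrite linearB /= linearZ /= trmx_mul trmxK CT.
  (* Given the tail [v], this first coordinate minimises the form of [Y]; the minimum is the form of
     the Schur complement at [v], which is therefore positive. *)
  pose w := col_mx (- a^-1 *: (b *m v)) v.
  have := posdefmx_dot (v := w) Ypd.
  have -> : w != 0.
    by apply: contraNneq v0; rewrite -[0]col_mx0 => /eq_col_mx[_ ->].
  move=> /(_ isT); rewrite /dot -mulmxA; congr (0 < _ 0 0).
  rewrite YE mul_block_col tr_col_mx mul_row_col mul_scalar_mx scalerA.
  rewrite mulrN divff ?gt_eqF // scaleN1r addNr mulmx0 add0r; congr (_ *m _).
  rewrite mulmxBl addrC -!scalemxAr -scalemxAl scaleNr; congr (_ - _ *: _).
  by rewrite mulmxA.
have sa0 : Num.sqrt a != 0 by rewrite gt_eqF ?sqrtr_gt0.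
pose G : 'M_(1 + n) := block_mx (Num.sqrt a)%:M 0 ((Num.sqrt a)^-1 *: b^T) H.
suff : Y = G *m G^T by exists G.
rewrite {1}YE /G tr_block_mx mulmx_block !trmx0 !mul0mx !mulmx0 !addr0 tr_scalar_mx.
rewrite -scalar_mxM -expr2 sqr_sqrtr ?ltW // linearZ /= trmxK.
rewrite mul_scalar_mx mul_mx_scalar !scalerA mulfV // !scale1r -HE.
rewrite -scalemxAl -scalemxAr scalerA -expr2 exprVn sqr_sqrtr ?ltW //.
by rewrite addrC subrK.
Qed.

(** For [W = G G^T] the squared length of [G^-1 v] is [<v, W^-1 v>], hence at most [|W^-1| |v|^2].
    The same bound holds for [G^-T], and is applied to [G^T u]. *)
Lemma dot_le_posdefmx n (W : 'M[F]_n) u : posdefmx W ->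
  dot u u <= spectral_norm (invmx W) * dot u (W *m u).
Proof.
move=> Wpd; have [G [Gu WE]] := cholesky Wpd.
have GTu : G^T \in unitmx by rewrite unitmx_tr.
have WV : invmx W = (invmx G)^T *m invmx G.
  have WG : W *m ((invmx G)^T *m invmx G) = 1%:M.
    by rewrite WE trmx_inv -mulmxA mulKVmx ?mulmxV.
  by rewrite -[LHS]mulmx1 -WG mulKmx ?posdefmx_unit.
have Ginv v : dot (invmx G *m v) (invmx G *m v)
    <= spectral_norm (invmx W) * dot v v.
  by rewrite dot_mulmxr dotC mulmxA -WV dot_mulmx_spectral.
have := dot_trmx_bound (spectral_norm_ge0 _) Ginv (G^T *m u).
by rewrite trmx_inv mulKmx // WE -mulmxA dot_mulmxr.
Qed.

(** * Consequences of the constraints of the semidefinite program *)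

Lemma closed_loop_le d p (S : 'M[F]_(d + p)) (A : 'M_d) (B : 'M_(d, p)) v :
  let X := ulsubmx S in let M := A + B *m ((ursubmx S)^T *m invmx X) in
  psdmx S -> X \in unitmx ->
  dot v (M *m X *m M^T *m v) <= dot v (row_mx A B *m S *m (row_mx A B)^T *m v).
Proof.
move=> X M Spsd Xu; have ST : S^T = S by case: Spsd.
set K := (ursubmx S)^T *m invmx X in M *.
(* Here [[A B] = M E + B N], where [N] sends [(x, u)] to the deviation [u - K x]. The choice of [K]
   makes [N S E^T] vanish, so the cross terms disappear and only a positive semidefinite term is
   left besides [M X M^T]. *)
pose E : 'M[F]_(d, d + p) := row_mx 1%:M 0.
pose N : 'M[F]_(p, d + p) := row_mx (- K) 1%:M.
have ABE : row_mx A B = M *m E + B *m N.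
  rewrite !mul_mx_row add_row_mx !mulmx1 mulmx0 add0r mulmxN /M.
  by rewrite addrK.
clearbody M.
have ESE : E *m S *m E^T = X.
  rewrite -[S]submxK mul_row_block tr_row_mx mul_row_col trmx1 trmx0.
  by rewrite !mul1mx !mul0mx !mulmx1 !mulmx0 !addr0.
have NSE : N *m S *m E^T = 0.
  rewrite -[S]submxK mul_row_block tr_row_mx mul_row_col trmx1 trmx0.
  rewrite mulmx1 mulmx0 addr0 mul1mx mulNmx /K mulmxKV //.
  by rewrite trmx_ursub ST addNr.
have ESN : E *m S *m N^T = 0.
  by apply: trmx_inj; rewrite !trmx_mul trmxK ST mulmxA NSE trmx0.
have -> : row_mx A B *m S *m (row_mx A B)^T
    = M *m X *m M^T + (B *m N) *m S *m (B *m N)^T.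
  rewrite ABE linearD /= !mulmxDl !mulmxDr !trmx_mul.
  have -> : M *m E *m S *m (E^T *m M^T) = M *m X *m M^T.
    by rewrite -ESE !mulmxA.
  have -> : M *m E *m S *m (N^T *m B^T) = 0.
    have -> : M *m E *m S *m (N^T *m B^T) = M *m (E *m S *m N^T) *m B^T.
      by rewrite !mulmxA.
    by rewrite ESN mulmx0 mul0mx.
  have -> : B *m N *m S *m (E^T *m M^T) = 0.
    have -> : B *m N *m S *m (E^T *m M^T) = B *m (N *m S *m E^T) *m M^T.
      by rewrite !mulmxA.
    by rewrite NSE mulmx0 mul0mx.
  by rewrite addr0 add0r.
rewrite mulmxDl dotDr lerDl -[in leRHS]mulmxA -[in leRHS]mulmxA dot_mulmxr.
exact: psdmx_dot.
Qed.

(** Take [H] with [H H^T = X], where [X = P + W] is the state block. The first bound is [0 <= P],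
    the second is [P <= alpha X], and the third adds [closed_loop_le] to the latter. *)
Lemma coco_lq_gain_factor d p (Q W : 'M[F]_d) (R : 'M_p) (A : 'M_d)
    (B : 'M_(d, p)) (K : 'M_(p, d)) alpha :
  posdefmx W -> coco_lq_gain Q R W A B alpha K ->
  exists H : 'M[F]_d, H \in unitmx /\ forall v,
    [/\ dot v (W *m v) <= dot (H^T *m v) (H^T *m v),
        (1 - alpha) * dot (H^T *m v) (H^T *m v) <= dot v (W *m v)
      & dot (((A + B *m K) *m H)^T *m v) (((A + B *m K) *m H)^T *m v)
          <= alpha * dot (H^T *m v) (H^T *m v)].
Proof.
move=> Wpd [S [[[ST XE Spsd Sle] _] KE]]; set X := ulsubmx S in XE Sle KE.
set P := row_mx A B *m S *m (row_mx A B)^T in XE Sle.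
have P_ge0 v : 0 <= dot v (P *m v).
  by rewrite /P -!mulmxA dot_mulmxr psdmx_dot.
have Xdot v : dot v (X *m v) = dot v (P *m v) + dot v (W *m v).
  by rewrite XE mulmxDl dotDr.
have Xpd : posdefmx X.
  split=> [|v v0]; first by rewrite /X trmx_ulsub ST.
  by rewrite -mulmxA -/(dot _ _) Xdot ltr_wpDl ?P_ge0 ?posdefmx_dot.
have [H [Hu XH]] := cholesky Xpd.
have HX v : dot (H^T *m v) (H^T *m v) = dot v (X *m v).
  by rewrite XH -mulmxA dot_mulmxr.
have PX v : dot v (P *m v) <= alpha * dot v (X *m v).
  have := psdmx_dot v Sle.
  by rewrite mulmxBl -scalemxAl dotDr -scaleN1r !dotZr mulN1r subr_ge0.
exists H; split=> // v; rewrite HX; split.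
- by rewrite Xdot lerDr.
- by rewrite mulrBl mul1r lerBlDr {1}Xdot addrC lerD2l PX.
apply: le_trans (PX v); rewrite trmx_mul -mulmxA HX XH.
have := closed_loop_le A B v Spsd (posdefmx_unit Xpd).
rewrite /= -/X -KE -/P; apply: le_trans.
by rewrite -XH -[in leRHS]mulmxA -[in leRHS]mulmxA [in leRHS]dot_mulmxr.
Qed.

End SpectralNorm.

(** * Verification of sequential strong stability *)

Theorem lemma5 (F : realType) (d p : nat) (hd : (0 < d)%N)
    (Q : 'M[F]_d) (R : 'M[F]_p) (W : 'M[F]_d)
    (hQ : posdefmx Q) (hR : posdefmx R) (hW : posdefmx W)
    (alpha : F) (halpha : 0 <= alpha < 2^-1)
    (A : nat -> 'M[F]_d) (B : nat -> 'M[F]_(d, p)) (K : nat -> 'M[F]_(p, d))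
    (hfeas : forall t, (1 <= t)%N ->
       exists S, sdp_feasible W (A t) (B t) alpha S)
    (hK : forall t, (1 <= t)%N ->
       coco_lq_gain Q R W (A t) (B t) alpha (K t)) :
  let kappaW := spectral_norm W * spectral_norm (invmx W) in
  seq_strongly_stable A B K
    (kappaW / Num.sqrt (1 - alpha))
    (1 - Num.sqrt alpha)
    (Num.sqrt (alpha / (1 - alpha))).
Proof.
move=> kappaW.
have /andP[a0 ah] := halpha.
have a1 : 0 < 1 - alpha by lra.
have k1 : 1 <= kappaW by apply: spectral_norm_cond_ge1; rewrite ?posdefmx_unit.
have nW0 : 0 <= spectral_norm W by exact: spectral_norm_ge0.
have nV0 : 0 <= spectral_norm (invmx W) by exact: spectral_norm_ge0.
set w := spectral_norm W in kappaW k1 nW0 *.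
set w' := spectral_norm (invmx W) in kappaW k1 nV0 *.
have kgt0 : 0 < kappaW by lra.
have w_gt0 : 0 < w.
  rewrite lt0r nW0 andbT; apply: contraTneq kgt0 => w0.
  by rewrite /kappaW w0 mul0r ltxx.
have w'_gt0 : 0 < w' by rewrite -(pmulr_rgt0 _ w_gt0).
have s_gt0 : 0 < Num.sqrt (1 - alpha) by rewrite sqrtr_gt0.
have sw_gt0 : 0 < Num.sqrt w' by rewrite sqrtr_gt0.
have sa_lt1 : Num.sqrt alpha < 1 by rewrite -[ltRHS]sqrtr1 ltr_sqrt //; lra.
split.
- by rewrite divr_gt0.
- by rewrite subr_gt0 sa_lt1 lerBlDr lerDl sqrtr_ge0.
(* The ratio [alpha / (1 - alpha)] is below 1 exactly because [alpha < 1/2]. *)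
- by rewrite sqrtr_ge0 -[ltRHS]sqrtr1 ltr_sqrt // ltr_pdivrMr //; lra.
(* The guard [1 <= t] sits under the existential so that [choice] yields a factor for every index;
   at 0 an arbitrary matrix serves. *)
have {}hK t : exists H : 'M[F]_d, (1 <= t)%N -> H \in unitmx /\ forall v,
    [/\ dot v (W *m v) <= dot (H^T *m v) (H^T *m v),
        (1 - alpha) * dot (H^T *m v) (H^T *m v) <= dot v (W *m v)
      & dot (((A t + B t *m K t) *m H)^T *m v) (((A t + B t *m K t) *m H)^T *m v)
          <= alpha * dot (H^T *m v) (H^T *m v)].
  case: t => [|t]; first by exists 0.
  by have [H ?] := coco_lq_gain_factor hW (hK t.+1 isT); exists H.
have [H Hfac] := choice hK.
(* The estimates give [sqrt (w / (1 - alpha))] for [H]; it is enlarged by [sqrt (w * w') >= 1] so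
   that [beta1 / beta2] is exactly the stated [kappa]. *)
exists (w * Num.sqrt w' / Num.sqrt (1 - alpha)), (Num.sqrt w')^-1, H.
exists (fun t => invmx (H t) *m (A t + B t *m K t) *m H t).
split; rewrite ?invr_gt0 ?divr_gt0 ?mulr_gt0 //.
  rewrite invrK [RHS]mulrAC; congr (_ / _).
  by rewrite -mulrA -expr2 sqr_sqrtr.
move=> t t1; have [Hu Ht] := Hfac t t1; have [Gu Gt] := Hfac t.+1 isT.
have HV s v : H s \in unitmx -> (H s)^T *m ((invmx (H s))^T *m v) = v.
  by move=> ?; rewrite trmx_inv mulKVmx ?unitmx_tr.
split.
- by rewrite !mulmxA mulmxV // mul1mx mulmxK.
(* With [u = H^-T v], [L^T v] is [((A + B K) H)^T u], of squared length at most
   [alpha |H^T u|^2 = alpha |v|^2]. *)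
- rewrite subKr; apply: spectral_norm_trmx_le; rewrite ?sqrtr_ge0 // => v.
  rewrite sqr_sqrtr // -mulmxA trmx_mul -mulmxA.
  by have [_ _] := Ht ((invmx (H t))^T *m v); rewrite HV.
- split.
    apply: spectral_norm_trmx_le => [|v].
      by rewrite divr_ge0 ?mulr_ge0 ?sqrtr_ge0.
    have [_ h _] := Ht v; rewrite expr_div_n exprMn !sqr_sqrtr ?(ltW a1) //.
    rewrite [leRHS]mulrAC ler_pdivlMr // mulrC (le_trans h) //.
    rewrite (le_trans (dot_mulmx_spectral _ _)) // ler_wpM2r ?dotvv_ge0 //.
    (* The slack [w <= w^2 * w'] is [1 <= kappaW]. *)
    by rewrite -/w expr2 -mulrA ler_peMr.
  rewrite invrK; apply: spectral_norm_trmx_le => [|v]; first exact: sqrtr_ge0.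
  rewrite sqr_sqrtr //; set u := _ *m v.
  apply: le_trans (dot_le_posdefmx u hW) _; rewrite ler_wpM2l //.
  by have [+ _ _] := Ht u; rewrite HV.
(* The guard [gamma < 1] means [alpha > 0], so [sqrt alpha] cancels in [rho / (1 - gamma)]. *)
move=> g1; have sa_gt0 : 0 < Num.sqrt alpha by lra.
have -> : Num.sqrt (alpha / (1 - alpha)) / (1 - (1 - Num.sqrt alpha))
    = (Num.sqrt (1 - alpha))^-1.
  by rewrite subKr sqrtrM // sqrtrV ?ltW // mulrAC divff ?mul1r // gt_eqF.
apply: spectral_norm_trmx_le => [|v]; first by rewrite invr_ge0 ltW.
rewrite exprVn sqr_sqrtr ?(ltW a1) // mulrC ler_pdivlMr // mulrC.
(* For [u = H_(t+1)^-T v], [W] links consecutive times: [(1 - alpha) |H_t^T u|^2 <= <u, W u> <=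
   |H_(t+1)^T u|^2 = |v|^2]. *)
rewrite trmx_mul -mulmxA; set u := _ *m v.
have [_ h _] := Ht u; apply: le_trans h _.
by have [+ _ _] := Gt u; rewrite HV.
Qed.
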